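(* Suppose the starting indices of the $N_{\mathrm{sample}}$ patches are sampled i.i.d. from the uniform distribution on the finite admissible set of starting indices. Then for each support $s$, the expected square deviation between its empirical probability $p_s$ and its true probability $q_s$ satisfies $$\mathbb E\bigl[(p_s-q_s)^2\bigr]=\frac{q_s(1-q_s)}{N_{\mathrm{sample}}}.$$ Moreover, as $N_{\mathrm{sample}}\to\infty$, $$\sqrt{N_{\mathrm{sample}}}\,(p_s-q_s)\;\xrightarrow{d}\;\mathcal N\bigl(0,\,q_s(1-q_s)\bigr).$$
   Context: A space-time grid with $N_x$ spatial and $N_t$ temporal intervals and positive integers $m_x,m_t$ (with $3m_x<N_x$, $m_t<N_t$) are fixed. A patch is determined by its starting indices $(j,n)$; the admissible set of starting indices is $\{0,1,\dots,N_x-3m_x-1\}\times\{0,1,\dots,N_t-m_t-1\}$. A deterministic identification map (a deterministic algorithm) assigns to each admissible patch a support, i.e. a subset of the finite dictionary index set $\{1,\dots,L\}$. For sampled patches $\mathcal B_1,\dots,\mathcal B_{N_{\mathrm{sample}}}$, let $\mathbf s_i$ be the support assigned to $\mathcal B_i$. The empirical probability of a support $s$ is $p_s=\frac1{N_{\mathrm{sample}}}\#\{i:\mathbf s_i=s\}$, and its true probability $q_s$ is the fraction of all admissible patches to which the map assigns $s$ (exhaustive sampling over all admissible patches), equivalently the probability that one uniformly sampled patch yields $s$. $\mathcal N(0,0)$ denotes the point mass at $0$, and $\xrightarrow{d}$ denotes convergence in distribution. *)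

(* Defs.v *)
From HB Require Import structures.
From mathcomp Require Import all_boot all_order all_algebra.
From mathcomp Require Import all_classical all_reals all_analysis.
From mathcomp Require Import measurable_realfun.

Set Implicit Arguments.
Unset Strict Implicit.
Unset Printing Implicit Defensive.

Import Order.TTheory GRing.Theory Num.Theory.
Import numFieldNormedType.Exports.

Local Open Scope classical_set_scope.
Local Open Scope ring_scope.

Record grid := Grid {
  Nx : nat;
  Nt : nat;
  mx : nat;
  mt : nat;
  mx_gt0 : (0 < mx)%N;
  mt_gt0 : (0 < mt)%N;
  mx_lt : (3 * mx < Nx)%N;
  mt_lt : (mt < Nt)%N }.

(* A patch is identified with its starting indices (j, n); it carries the
   discrete sigma-algebra.  The point required by measurableType is (0, 0),
   which is admissible by mx_lt and mt_lt. *)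
Definition grid_patch (g : grid) : Type :=
  ('I_(Nx g - 3 * mx g) * 'I_(Nt g - mt g))%type.

Section patch_structures.
Variable g : grid.

HB.instance Definition _ := Finite.copy (grid_patch g)
  ('I_(Nx g - 3 * mx g) * 'I_(Nt g - mt g))%type.

Let j_gt0 : (0 < Nx g - 3 * mx g)%N. Proof. by rewrite subn_gt0 mx_lt. Qed.
Let n_gt0 : (0 < Nt g - mt g)%N. Proof. by rewrite subn_gt0 mt_lt. Qed.

HB.instance Definition _ := isPointed.Build (grid_patch g)
  (Ordinal j_gt0, Ordinal n_gt0).

HB.instance Definition _ := @isMeasurable.Build default_measure_display
  (grid_patch g) discrete_measurable discrete_measurable0
  discrete_measurableC discrete_measurableU.

End patch_structures.

Definition mutually_independent (R : realType) (d d' : measure_display)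
    (T : measurableType d) (T' : measurableType d') (P : probability T R)
    (I : finType) (X : I -> {RV P >-> T'}) : Prop :=
  forall (J : {set I}) (A : I -> set T'), (forall i, measurable (A i)) ->
    P (\bigcap_(i in [set i | i \in J]) (X i @^-1` A i)) =
    (\prod_(i in J) P (X i @^-1` A i))%E.

Definition uniform_on_patches (R : realType) (d : measure_display)
    (T : measurableType d) (P : probability T R) (g : grid)
    (X : {RV P >-> grid_patch g}) : Prop :=
  forall a : grid_patch g,
    distribution P X [set a] = (#|{: grid_patch g}|%:R^-1)%:E.

Definition iid_uniform (R : realType) (d : measure_display)
    (T : measurableType d) (P : probability T R) (g : grid) (N : nat)
    (X : 'I_N -> {RV P >-> grid_patch g}) : Prop :=
  mutually_independent X /\ forall i, uniform_on_patches (X i).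

(* The dictionary index set {1, ..., L} is represented by 'I_L, so that a
   support is an element of {set 'I_L}. *)
Section support_probabilities.
Variables (R : realType) (g : grid) (L : nat).
Variables (ident : grid_patch g -> {set 'I_L}) (s : {set 'I_L}).

Definition true_prob : R :=
  #|[set a : grid_patch g | ident a == s]%SET|%:R / #|{: grid_patch g}|%:R.

Section empirical.
Variables (d : measure_display) (T : measurableType d) (P : probability T R).
Variables (N : nat) (X : 'I_N -> {RV P >-> grid_patch g}).

Definition empirical_prob (w : T) : R :=
  #|[set i : 'I_N | ident (X i w) == s]%SET|%:R / N%:R.

Lemma measurable_empirical_prob : measurable_fun [set: T] empirical_prob.
Proof.
have -> : empirical_prob = fun w =>
    (\sum_(i < N) \1_((ident \o X i) @^-1` [set s]) w) * N%:R^-1.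
  apply/funext => w; rewrite /empirical_prob -sum1_card natr_sum big_mkcond/=.
  congr (_ * _); apply: eq_bigr => i _; rewrite indicE inE.
  by case: eqP => [e|ne]; [rewrite mem_set | rewrite memNset].
apply: measurable_funM; last exact: measurable_cst.
apply: measurable_sum => i; apply: measurable_indic.
rewrite comp_preimage -[X in measurable X]setTI.
exact: (measurable_funPT (X i)).
Qed.

HB.instance Definition _ :=
  isMeasurableFun.Build _ _ _ _ empirical_prob measurable_empirical_prob.

Definition scaled_deviation (w : T) : R :=
  Num.sqrt N%:R * (empirical_prob w - true_prob).

Lemma measurable_scaled_deviation : measurable_fun [set: T] scaled_deviation.
Proof.
apply: measurable_funM; first exact: measurable_cst.
by apply: measurable_funB; [exact: measurable_empirical_prob|
                            exact: measurable_cst].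
Qed.

HB.instance Definition _ :=
  isMeasurableFun.Build _ _ _ _ scaled_deviation measurable_scaled_deviation.

End empirical.
End support_probabilities.

(* N(m, v), parametrized by its variance v.  The degenerate case is separate
   because normal_prob m 0 is not the point mass at m (it is a junk value). *)
Definition gaussian (R : realType) (m v : R) :
    probability (measurableTypeR R) R :=
  if v == 0 then
    (\d_(m : measurableTypeR R) : probability (measurableTypeR R) R)
  else
    (normal_prob m (Num.sqrt v) : probability (measurableTypeR R) R).

(* The random variables may live on different probability spaces. *)
Definition cvg_in_distribution (R : realType) (d : nat -> measure_display)
    (T : forall n, measurableType (d n)) (P : forall n, probability (T n) R)
    (Y : forall n, {RV (P n) >-> R})
    (mu : probability (measurableTypeR R) R) : Prop :=
  forall x : R, {for x, continuous (fun r : R => mu `]-oo, r]%classic)} ->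
    cdf (Y n) x @[n --> \oo] --> mu `]-oo, x]%classic.

(* Main.v *)
Require Import Defs.
From HB Require Import structures.
From mathcomp Require Import all_boot all_order all_algebra.
From mathcomp Require Import all_classical all_reals all_analysis.
From mathcomp Require Import measurable_realfun ring lra.
Import Order.TTheory GRing.Theory Num.Theory.
Import numFieldNormedType.Exports.

(** The number [K] of samples that yield the support [s] is binomial with
    parameters [N] and [q], the true probability of [s], because the events
    that the successive samples yield [s] are independent, each of probability
    [q] ([integral_hit_count]).  The mean
    square deviation is therefore the variance of [K / N], and the convergence
    in distribution is the theorem of de Moivre and Laplace
    ([binomial_cdf_cvg]), proved here by Stein's method.

    Let [W = (K - N q) / sqrt N] and [v = q (1 - q)].  The ratio of consecutive
    binomial weights gives
    [E ((K - N q) f(K)) = E (q (N - K) (f(K + 1) - f(K)))]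
    for every [f] ([binomial_mean_stein]); with [f = 1] and [f k = k - N q] this
    yields the mean and the variance of [K], and with [f k = F (W k)] it shows
    that [E (v F'(W) - W F(W))] tends to [0] for every [F] with bounded,
    uniformly continuous derivative ([scaled_count_stein_bound]).

    If [h] is continuous with compact support and mean zero under the normal
    density [p] of variance [v], then [F = (1 / p) * (primitive of h p)] solves
    [v F' - x F = v h] and has compact support ([stein_equation_solution]);
    hence [E h(W)] tends to [0] ([binomial_mean_cvg0]).  Subtracting a multiple
    of a wide trapezoid, and controlling the tails of [W] by Chebyshev's
    inequality, extends this to convergence of [E h(W)] to the normal mean for
    all continuous [h] of compact support with values between [0] and [1]
    ([binomial_mean_cvg]).  Sandwiching the indicator of a half-line between
    trapezoids gives the convergence of the distribution functions.

    When [v = 0], the variance of [W] vanishes, so [W] is almost surely [0] and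
    its law is already the point mass ([binomial_mean_degenerate]). *)

Set Implicit Arguments.
Unset Strict Implicit.
Unset Printing Implicit Defensive.
Local Open Scope classical_set_scope.
Local Open Scope ring_scope.

(** * Binomial means *)

(** Probability that a binomial variable with parameters [n] and [q] takes
    the value [k]. *)
Definition binomial_weight (R : realType) (q : R) (n k : nat) : R :=
  'C(n, k)%:R * q ^+ k * (1 - q) ^+ (n - k).

(** Expectation of [f K] for [K] binomial with parameters [n] and [q], as a
    finite sum. *)
Definition binomial_mean (R : realType) (q : R) (n : nat) (f : nat -> R) : R :=
  \sum_(k < n.+1) binomial_weight q n k * f k.

(** The number [k] of successes among [n], centred and rescaled.  It is
    [(k - n q) / sqrt n] for positive [n], and [0] for [n = 0]. *)
Definition scaled_count (R : realType) (q : R) (n k : nat) : R :=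
  Num.sqrt n%:R * (k%:R / n%:R - q).

Section binomial_mean_theory.
Variables (R : realType) (q : R).
Implicit Types (n k : nat) (f g : nat -> R).
Local Notation E := (binomial_mean q).
Local Notation w := (binomial_weight q).

Lemma binomial_mean_cst n c : E n (fun=> c) = c.
Proof.
rewrite /binomial_mean -mulr_suml.
suff -> : \sum_(k < n.+1) w n k = 1 by rewrite mul1r.
have /(congr1 (fun x => x ^+ n)) := subrK q 1; rewrite exprDn expr1n => <-.
by apply: eq_bigr => k _; rewrite /binomial_weight -mulr_natl; ring.
Qed.

Lemma binomial_meanD n f g : E n (fun k => f k + g k) = E n f + E n g.
Proof.
by rewrite /binomial_mean -big_split; apply: eq_bigr => k _; rewrite mulrDr.
Qed.

Lemma binomial_meanZ n c f : E n (fun k => c * f k) = c * E n f.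
Proof.
by rewrite /binomial_mean mulr_sumr; apply: eq_bigr => k _; rewrite mulrCA.
Qed.

Lemma eq_binomial_mean n f g : (forall k, (k <= n)%N -> f k = g k) ->
  E n f = E n g.
Proof. by move=> fg; apply: eq_bigr => k _; rewrite fg// -ltnS. Qed.

(** Discrete integration by parts: the binomial law is characterised by the
    ratio of its consecutive weights. *)
Lemma binomial_mean_stein n f :
  E n (fun k => (k%:R - n%:R * q) * f k) =
  E n (fun k => q * (n%:R - k%:R) * (f k.+1 - f k)).
Proof.
apply/eqP; rewrite -subr_eq0 /binomial_mean -sumrB; apply/eqP.
transitivity (\sum_(k < n.+1) ((1 - q) * w n k * k%:R * f k) -
              \sum_(k < n.+1) (q * w n k * (n - k)%:R * f k.+1)).
  rewrite -sumrB; apply: eq_bigr => k _.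
  by rewrite natrB -1?ltnS//; ring.
rewrite big_ord_recl mulr0 mul0r add0r big_ord_recr/= subnn mulr0 mul0r addr0.
apply/eqP; rewrite subr_eq0; apply/eqP; apply: eq_bigr => k _.
have kn : (k < n)%N by [].
rewrite /bump/= add1n /binomial_weight exprS (subnS n k).
have <- : (n - k).-1.+1 = (n - k)%N by rewrite prednK// subn_gt0.
(* The ratio of consecutive weights comes from [mul_bin_left]. *)
have /(congr1 (fun m => m%:R : R)) := mul_bin_left n k.
have <- : (n - k).-1.+1 = (n - k)%N by rewrite prednK// subn_gt0.
rewrite !natrM /= exprS => H.
transitivity ((k.+1%:R * 'C(n, k.+1)%:R) *
  (q * q ^+ k * (1 - q) * (1 - q) ^+ (n - k).-1 * f k.+1)).
  by ring.
by rewrite H; ring.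
Qed.

Lemma binomial_variance n : E n (fun k => (k%:R - n%:R * q) ^+ 2) =
  n%:R * (q * (1 - q)).
Proof.
have mean0 : E n (fun k => k%:R - n%:R * q) = 0.
  have := binomial_mean_stein n (fun=> 1).
  under eq_binomial_mean do rewrite mulr1.
  move=> ->; under eq_binomial_mean do rewrite subrr mulr0.
  by rewrite binomial_mean_cst.
under eq_binomial_mean do rewrite expr2.
rewrite (binomial_mean_stein n (fun k => k%:R - n%:R * q)).
transitivity (E n (fun k => (n%:R * (q * (1 - q))) + - q * (k%:R - n%:R * q))).
  by apply: eq_binomial_mean => k _; rewrite -natr1; ring.
by rewrite binomial_meanD binomial_mean_cst binomial_meanZ mean0 mulr0 addr0.
Qed.

Lemma scaled_countE n k : (0 < n)%N ->
  k%:R - n%:R * q = Num.sqrt n%:R * scaled_count q n k.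
Proof.
move=> n0; rewrite /scaled_count mulrA -expr2 sqr_sqrtr// mulrBr mulrCA.
rewrite divff ?mulr1//.
by rewrite pnatr_eq0 -lt0n.
Qed.

Lemma scaled_countS n k : (0 < n)%N ->
  scaled_count q n k.+1 = scaled_count q n k + (Num.sqrt n%:R)^-1.
Proof.
move=> n0; have s0 : Num.sqrt (n%:R : R) != 0.
  by rewrite gt_eqF// sqrtr_gt0 ltr0n.
apply: (mulfI s0); rewrite mulrDr -!scaled_countE// divff// -natr1; ring.
Qed.

Lemma scaled_count_variance n : (0 < n)%N ->
  E n (fun k => scaled_count q n k ^+ 2) = q * (1 - q).
Proof.
move=> n0; have n0' : (n%:R : R) != 0 by rewrite pnatr_eq0 -lt0n.
apply: (mulfI n0'); rewrite -binomial_variance -binomial_meanZ.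
apply: eq_binomial_mean => k _.
by rewrite (scaled_countE k n0) [RHS]exprMn sqr_sqrtr.
Qed.

Hypothesis q01 : 0 <= q <= 1.

Lemma binomial_weight_ge0 n k : 0 <= w n k.
Proof.
have /andP[q0 q1] := q01.
by rewrite !mulr_ge0// exprn_ge0// subr_ge0.
Qed.

Lemma le_binomial_mean n f g : (forall k, (k <= n)%N -> f k <= g k) ->
  E n f <= E n g.
Proof.
move=> fg; apply: ler_sum => k _.
by rewrite ler_wpM2l ?binomial_weight_ge0// fg// -ltnS.
Qed.

Lemma ler_norm_binomial_mean n f : `|E n f| <= E n (fun k => `|f k|).
Proof.
apply: (le_trans (ler_norm_sum _ _ _)); apply: ler_sum => k _.
by rewrite normrM ger0_norm ?binomial_weight_ge0.
Qed.

(** With [W] the scaled count and [v = q (1 - q)], the expectation of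
    [v F'(W) - W F(W)] is small when the increments of [F] over the spacing
    [d] of the values of [W] are of order [d] and close to those of its
    linear approximation.  This is [binomial_mean_stein] for
    [f k = F (W k)]. *)
Lemma scaled_count_stein_bound (F dF : R -> R) (C e : R) n : (0 < n)%N ->
  let d := (Num.sqrt n%:R)^-1 in
  (forall x, `|F (x + d) - F x| <= C * d) ->
  (forall x, `|F (x + d) - F x - d * dF x| <= e * d) ->
  `|E n (fun k => q * (1 - q) * dF (scaled_count q n k) -
                  scaled_count q n k * F (scaled_count q n k))| <=
  q * (1 - q) * e + C * d * (1 + q * (1 - q)).
Proof.
move=> n0 d FC Fe; have /andP[q0 q1] := q01.
set D := scaled_count q n.
have s0 : 0 < Num.sqrt (n%:R : R) by rewrite sqrtr_gt0 ltr0n.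
have sn : Num.sqrt (n%:R : R) != 0 by rewrite gt_eqF.
have nE : n%:R = Num.sqrt (n%:R : R) ^+ 2 by rewrite sqr_sqrtr.
have d0 : 0 < d by rewrite invr_gt0.
have stein : E n (fun k => D k * F (D k)) =
    E n (fun k => (q * (1 - q) / d - q * D k) * (F (D k + d) - F (D k))).
  apply: (mulfI sn); rewrite -!binomial_meanZ.
  have := binomial_mean_stein n (fun k => F (D k)).
  under eq_binomial_mean do rewrite scaled_countE// -mulrA.
  move=> ->; apply: eq_binomial_mean => k _.
  rewrite /D scaled_countS// -/D -/d mulrA; congr (_ * _).
  have -> : n%:R - k%:R = n%:R * (1 - q) - Num.sqrt n%:R * D k.
    by rewrite /D -scaled_countE//; ring.
  by rewrite /d invrK {1}nE; ring.
have -> : E n (fun k => q * (1 - q) * dF (D k) - D k * F (D k)) =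
    E n (fun k => - (q * (1 - q) / d) * (F (D k + d) - F (D k) - d * dF (D k)) +
                  q * D k * (F (D k + d) - F (D k))).
  have -> : E n (fun k => q * (1 - q) * dF (D k) - D k * F (D k)) =
      E n (fun k => q * (1 - q) * dF (D k)) - E n (fun k => D k * F (D k)).
    rewrite -[X in _ = _ + X]mulN1r -binomial_meanZ -binomial_meanD.
    by apply: eq_binomial_mean => k _; rewrite mulN1r.
  rewrite stein -[X in _ + X = _]mulN1r -binomial_meanZ -binomial_meanD.
  apply: eq_binomial_mean => k _.
  by field; rewrite gt_eqF.
apply: (le_trans (ler_norm_binomial_mean _ _)).
have -> : q * (1 - q) * e + C * d * (1 + q * (1 - q)) =
    E n (fun k => q * (1 - q) * e + C * d * (1 + D k ^+ 2)).
  rewrite binomial_meanD binomial_mean_cst binomial_meanZ binomial_meanD.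
  rewrite binomial_mean_cst.
  by rewrite scaled_count_variance.
apply: le_binomial_mean => k _.
apply: (le_trans (ler_normD _ _)); apply: lerD.
  have vd : 0 <= q * (1 - q) / d.
    by apply: divr_ge0 (ltW d0); rewrite mulr_ge0// subr_ge0.
  rewrite normrM normrN (ger0_norm vd).
  have -> : q * (1 - q) * e = q * (1 - q) / d * (e * d).
    by field; rewrite gt_eqF.
  by rewrite ler_wpM2l.
rewrite normrM mulrC; apply: ler_pM => //.
rewrite normrM (ger0_norm q0).
apply: (@le_trans _ _ `|D k|); first by rewrite ler_piMl.
have := sqr_ge0 (`|D k| - 1).
have := normr_ge0 (D k).
rewrite -[D k ^+ 2](real_normK (num_real _)); nra.
Qed.

End binomial_mean_theory.

(** When [q (1 - q) = 0] the variance of the scaled count vanishes, so every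
    nonzero value of the scaled count has weight zero. *)
Lemma binomial_mean_degenerate (R : realType) (q : R) (n : nat) (f : R -> R) :
  0 <= q <= 1 -> q * (1 - q) = 0 -> (0 < n)%N ->
  binomial_mean q n (fun k => f (scaled_count q n k)) = f 0.
Proof.
move=> q01 v0 n0.
have := scaled_count_variance q n0; rewrite v0 => /eqP.
rewrite psumr_eq0; last first.
  by move=> k _; rewrite mulr_ge0 ?sqr_ge0// binomial_weight_ge0.
move=> /allP w0; rewrite -[RHS](binomial_mean_cst q n); apply: eq_bigr => k _.
have := w0 k (mem_index_enum _); rewrite /= mulf_eq0 sqrf_eq0.
by move=> /orP[/eqP ->|/eqP ->]; rewrite ?mul0r.
Qed.

(** * Stein's equation for the normal law *)

Section compact_support.
Variables (R : realType) (f : R -> R) (B : R).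
Hypotheses (cf : continuous f) (f0 : forall x, B <= `|x| -> f x = 0).

Lemma compact_support_bounded : exists2 C : R, 0 < C & forall x, `|f x| <= C.
Proof.
have [M [_ /(_ (`|M| + 1)) HM]] : bounded_set (f @` `[- `|B|, `|B|]).
  apply/compact_bounded/continuous_compact; last exact: segment_compact.
  exact: continuous_subspaceT.
exists (`|M| + 1); first by rewrite ltr_wpDl.
move=> x; have [xB|Bx] := leP B `|x|; first by rewrite f0// normr0 addr_ge0.
apply: HM; first by rewrite (le_lt_trans (ler_norm M))// ltrDl.
exists x => //=; rewrite in_itv/=.
by rewrite -ler_norml (le_trans (ltW Bx))// ler_norm.
Qed.

(** Heine's theorem for functions that vanish outside a bounded interval. *)
Lemma compact_support_unif_continuous e : 0 < e -> exists2 d : R, 0 < d &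
  forall t x, 0 <= t <= d -> `|f (x + t) - f x| <= e.
Proof.
move=> e0.
(* One unit of margin around the support, so that [x + t] is outside the
   support when [x] is outside [K] and [0 <= t < 1]. *)
pose K := `[- `|B| - 1, `|B| + 1]%classic : set R.
have /compact_near_coveringP cK : compact K by exact: segment_compact.
pose P (d x : R) := forall t, 0 <= t <= d -> `|f (x + t) - f x| <= e.
(* By [compact_near_coveringP] it suffices to bound the oscillation locally. *)
have near_P x : K x -> \forall x' \near x & d \near (0:R)^'+, P d x'.
  move=> _; have /cvgrPdist_le/(_ (e / 2)) := @cf x.
  rewrite divr_gt0// => /(_ isT)/nbhs_ballP[r /= r0 fr].
  exists (ball x (r / 2), [set d | d < r / 2]) => /=.
    split; first by apply: nbhsx_ballx; rewrite divr_gt0.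
    by apply: nbhs_right_lt; rewrite divr_gt0.
  move=> [x' d]/= [xx' dr] t /andP[t0 td].
  have r2 : r = r / 2 + r / 2 by rewrite -splitr.
  have H1 : `|f x - f x'| <= e / 2.
    by apply: fr; apply: le_ball xx'; rewrite ler_pdivrMr// ler_pMr// ler1n.
  have H2 : `|f x - f (x' + t)| <= e / 2.
    apply: fr; rewrite /ball/= opprD addrA r2 (le_lt_trans (ler_normB _ _))//.
    by rewrite ltrD// ger0_norm// (le_lt_trans td).
  have -> : f (x' + t) - f x' = (f x - f x') - (f x - f (x' + t)) by ring.
  rewrite [leRHS]splitr; apply: (le_trans (ler_normB _ _)); exact: lerD.
have := cK _ _ P _ near_P => H.
have [d [d0 d1 dP]] : exists d : R, [/\ 0 < d, d < 1 & K `<=` P d].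
  near (0 : R)^'+ => d.
  exists d; split.
  - by near: d; exact: nbhs_right_gt.
  - by near: d; exact: nbhs_right_lt.
  - by near: d; exact: H.
exists d => // t x td.
have [xB|Bx] := leP `|x| (`|B| + 1).
  by apply: dP => //; rewrite /K/= in_itv/= -opprD -ler_norml.
have B1 := ler_norm B.
rewrite !f0 ?subr0 ?normr0 ?(ltW e0)//; first by lra.
have := lerB_normD x t; move: td => /andP[t0 td].
by rewrite (ger0_norm t0); lra.
Unshelve. all: by end_near. Qed.

End compact_support.

Section stein_equation.
Variables (R : realType) (s : R) (h : R -> R) (B : R).
Hypotheses (s0 : s != 0) (ch : continuous h).
Hypothesis h0 : forall x, B <= `|x| -> h x = 0.
Local Notation mu := (@lebesgue_measure R).
Local Notation p := (normal_pdf 0 s).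

Lemma integrable_mul_normal_pdf :
  mu.-integrable [set: R] (EFin \o (fun x => h x * p x)).
Proof.
have [C C0 hC] := compact_support_bounded ch h0.
apply: (@integrableMr _ _ _ mu _ _ h (EFin \o p)) => //.
- exact: continuous_measurable_fun.
- exists C; split=> [|M CM x _]; first exact: num_real.
  exact: le_trans (hC x) (ltW CM).
- exact: integrable_normal_pdf.
Qed.

(* The primitive of [h p]; it has compact support when [h p] has integral
   zero. *)
Let G (x : R) : R := \int[mu]_(t in `]-oo, x]) (h t * p t).

Let is_derive_G (x : R) : is_derive x (1 : R) G (h x * p x).
Proof.
have ihp y : mu.-integrable `]-oo, y] (EFin \o (fun x => h x * p x)).
  by apply: integrableS integrable_mul_normal_pdf.
have := @continuous_FTC1 R (fun x => h x * p x) -oo%O x (x + 1).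
rewrite ltrDl ltr01 => /(_ isT (ihp _) (ltNyr _)) [].
  by apply: cvgM; [exact: ch|exact: continuous_normal_pdf].
move=> dG <-; apply: (DeriveDef dG).
by rewrite derive1E.
Qed.

Hypothesis Ih : \int[mu]_x (h x * p x) = 0.

Let G0 x : B <= `|x| -> G x = 0.
Proof.
move=> Bx; rewrite /G Rintegral_mkcond.
have [x0|x0] := leP 0 x.
  rewrite -[RHS]Ih; apply: eq_Rintegral => y _.
  rewrite patchE; case: ifPn => //; rewrite notin_setE/= in_itv/= => /negP.
  rewrite -ltNge => xy; rewrite h0 ?mul0r//.
  by rewrite (le_trans Bx)// !ger0_norm// ?(le_trans x0)// ltW.
transitivity (\int[mu]_x (cst (0:R) x)); last first.
  by rewrite Rintegral_cst// mul0r.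
apply: eq_Rintegral => y _.
rewrite patchE; case: ifPn => //; rewrite inE/= in_itv/= => yx.
rewrite h0 ?mul0r//.
by rewrite (le_trans Bx)// !ler0_norm// ?lerN2// ?(le_trans yx)// ltW.
Qed.

(** Stein's equation for the centred normal law of variance [s ^ 2].  Because
    [h] has compact support and mean zero, the solution has compact support:
    no estimate of Gaussian tails is needed to bound its derivative. *)
Lemma stein_equation_solution : exists F dF : R -> R,
  [/\ forall x : R, is_derive x (1 : R) F (dF x),
      forall x, s ^+ 2 * dF x - x * F x = s ^+ 2 * h x,
      continuous dF & forall x, B <= `|x| -> dF x = 0].
Proof.
(* [F] is [G / p], as [k * expR (u x)] is the inverse of [p x]. *)
pose k : R := (normal_peak s)^-1.
pose c : R := (s ^+ 2 *+ 2)^-1.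
pose u (x : R) := x * (x * c).
pose F (x : R) := k * (expR (u x) * G x).
have v0 : s ^+ 2 != 0 by rewrite sqrf_eq0.
have dF (x : R) : is_derive x (1 : R) F (x / s ^+ 2 * F x + h x).
  have du : is_derive x (1 : R) u (x / s ^+ 2).
    have du1 : is_derive x (1 : R) (fun y : R => y * c) c.
      have := is_deriveM (is_derive_id x (1 : R)) (is_derive_cst c x 1).
      by rewrite /GRing.scale/= mulr0 add0r mulr1.
    have := is_deriveM (is_derive_id x (1 : R)) du1.
    rewrite /GRing.scale/= => H; apply: is_derive_eq H _.
    by rewrite /c; field.
  have H := is_deriveM (is_derive1_comp (is_derive_expR (u x)) du)
    (is_derive_G x).
  have := is_deriveM (is_derive_cst k x 1) H.
  rewrite /GRing.scale/= => H'; apply: is_derive_eq H' _.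
  rewrite mulr0 addr0 /F normal_pdfE//.
  have pk : normal_peak s != 0 by rewrite gt_eqF// normal_peak_gt0.
  have -> : normal_fun 0 s x = (expR (u x))^-1.
    by rewrite -expRN /normal_fun subr0 /u /c; congr expR; ring.
  have eu : expR (u x) != 0 by rewrite gt_eqF// expR_gt0.
  rewrite /k /comp; field.
  by rewrite pk eu s0.
have cF : continuous F.
  move=> x; apply: differentiable_continuous; apply/derivable1_diffP.
  by have [] := dF x.
exists F, (fun x => x / s ^+ 2 * F x + h x); split => //.
- by move=> x; field.
- move=> x; apply: cvgD; last exact: ch.
  by apply: cvgM; [apply: cvgM; [exact: cvg_id|exact: cvg_cst]|exact: cF].
- by move=> x Bx; rewrite h0// addr0 /F G0// !mulr0.
Qed.

End stein_equation.

(** * Trapezoids and normal means *)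

Section trapezoid.
Variable R : realType.
Implicit Types a b c x : R.

(** For [a <= b] and [0 < c], the continuous piecewise affine function that is
    [1] on the interval from [a] to [b], is [0] at distance at least [c] from
    it, and is affine in between. *)
Definition trapezoid a b c : R -> R :=
  cst 0 \max (cst 1 \min
    ((fun x => (x - a) / c + 1) \min (fun x => (b - x) / c + 1))).

Lemma continuous_trapezoid a b c : continuous (trapezoid a b c).
Proof.
move=> x; apply: continuous_max; first exact: cvg_cst.
apply: continuous_min; first exact: cvg_cst.
apply: continuous_min; (apply: cvgD; last exact: cvg_cst);
  (apply: cvgM; last exact: cvg_cst); apply: cvgB;
  by [exact: cvg_id|exact: cvg_cst].
Qed.

Lemma trapezoid_ge0 a b c x : 0 <= trapezoid a b c x.
Proof. by rewrite /trapezoid /= le_max lexx. Qed.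

Lemma trapezoid_le1 a b c x : trapezoid a b c x <= 1.
Proof. by rewrite /trapezoid /= ge_max ler01 /= ge_min lexx. Qed.

Lemma trapezoid1 a b c x : 0 < c -> a <= x <= b -> trapezoid a b c x = 1.
Proof.
move=> c0 /andP[ax xb].
have H1 : 1 <= (x - a) / c + 1 by rewrite lerDr divr_ge0 ?subr_ge0// ltW.
have H2 : 1 <= (b - x) / c + 1 by rewrite lerDr divr_ge0 ?subr_ge0// ltW.
rewrite /trapezoid /= (@min_l _ _ 1) ?max_r//.
by rewrite le_min H1 H2.
Qed.

Lemma trapezoid0l a b c x : 0 < c -> x <= a - c -> trapezoid a b c x = 0.
Proof.
move=> c0 xa; rewrite /trapezoid /= max_l// !ge_min.
suff -> : (x - a) / c + 1 <= 0 by rewrite orbT.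
by rewrite -lerBrDr sub0r ler_pdivrMr// mulN1r; lra.
Qed.

Lemma trapezoid0r a b c x : 0 < c -> b + c <= x -> trapezoid a b c x = 0.
Proof.
move=> c0 xb; rewrite /trapezoid /= max_l// !ge_min.
suff -> : (b - x) / c + 1 <= 0 by rewrite !orbT.
by rewrite -lerBrDr sub0r ler_pdivrMr// mulN1r; lra.
Qed.

Lemma trapezoid_supp a b c x : 0 < c -> `|a| + `|b| + c <= `|x| ->
  trapezoid a b c x = 0.
Proof.
move=> c0; have := ler_norm (- a); have := ler_norm b; rewrite normrN.
have := normr_ge0 a; have := normr_ge0 b.
have [x0|x0] := leP 0 x; rewrite ?(ger0_norm x0) ?(ltr0_norm x0) => *.
  by apply: trapezoid0r => //; lra.
by apply: trapezoid0l => //; lra.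
Qed.

End trapezoid.

Section normal_facts.
Variables (R : realType) (s : R).
Hypothesis s0 : s != 0.
Local Notation mu := (@lebesgue_measure R).
Local Notation p := (normal_pdf 0 s).

(** The real-valued distribution function of the centred normal law with
    standard deviation [s]. *)
Definition normal_cdf (x : R) : R := \int[mu]_(t in `]-oo, x]) p t.

Lemma normal_probE (x : R) :
  normal_prob 0 s `]-oo, x]%classic = (normal_cdf x)%:E.
Proof.
rewrite /normal_cdf /Rintegral fineK//; apply: integrable_fin_num => //.
by apply: integrableS (integrable_normal_pdf 0 s).
Qed.

Let ip (A : set R) : measurable A -> mu.-integrable A (EFin \o p).
Proof. by move=> mA; apply: integrableS (integrable_normal_pdf 0 s). Qed.

Lemma continuous_normal_cdf : continuous normal_cdf.
Proof.
move=> x; apply: differentiable_continuous; apply/derivable1_diffP.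
have := @continuous_FTC1 R p -oo%O x (x + 1).
rewrite ltrDl ltr01 => /(_ isT (ip _) (ltNyr _)) [] //.
exact: continuous_normal_pdf.
Qed.

(* The identity is a normal random variable on the space carrying its law. *)
Let idTR : measurableTypeR R -> R := idfun.
#[local] HB.instance Definition _ :=
  @isMeasurableFun.Build _ _ _ _ idTR (@measurable_id _ _ setT).

Let cdf_idE (x : R) :
  cdf (idTR : {RV normal_prob 0 s >-> R}) x = (normal_cdf x)%:E.
Proof. by rewrite -normal_probE. Qed.

Lemma normal_cdf_cvg1 : normal_cdf x @[x --> +oo] --> (1 : R).
Proof.
have := cvg_cdfy1 (idTR : {RV normal_prob 0 s >-> R}).
by rewrite (funext cdf_idE) => /fine_cvg.
Qed.

Lemma normal_cdf_cvg0 : normal_cdf x @[x --> -oo] --> (0 : R).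
Proof.
have := cvg_cdfNy0 (idTR : {RV normal_prob 0 s >-> R}).
by rewrite (funext cdf_idE) => /fine_cvg.
Qed.

Section bounds.
Variables (h : R -> R) (B : R).
Hypotheses (ch : continuous h) (h0 : forall x, B <= `|x| -> h x = 0).
Hypothesis h01 : forall x, 0 <= h x <= 1.

Let ih : mu.-integrable [set: R] (EFin \o (fun x => h x * p x)).
Proof. exact: integrable_mul_normal_pdf ch h0. Qed.

Let hp_ge0 x : 0 <= h x * p x.
Proof. by have /andP[? _] := h01 x; rewrite mulr_ge0// normal_pdf_ge0. Qed.

Lemma normal_mean_le1 : \int[mu]_x (h x * p x) <= 1.
Proof.
have -> : 1 = \int[mu]_x (p x) by rewrite /Rintegral integral_normal_pdf.
apply: le_Rintegral => //; first exact: ip.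
by move=> x _; rewrite ler_piMl ?normal_pdf_ge0//; have /andP[] := h01 x.
Qed.

Lemma normal_mean_ge0 : 0 <= \int[mu]_x (h x * p x).
Proof. by apply: Rintegral_ge0. Qed.

Lemma normal_mean_le_cdf b : (forall x, b < x -> h x = 0) ->
  \int[mu]_x (h x * p x) <= normal_cdf b.
Proof.
move=> hb; rewrite /normal_cdf [leRHS]Rintegral_mkcond.
apply: le_Rintegral => //.
  rewrite -restrict_EFin; apply/integrable_restrict => //.
  by rewrite setTI; exact: ip.
move=> x _; rewrite patchE; case: ifPn.
  by move=> _; rewrite ler_piMl ?normal_pdf_ge0//; have /andP[] := h01 x.
rewrite notin_setE/= in_itv/= => /negP; rewrite -ltNge => bx.
by rewrite hb// mul0r.
Qed.

Lemma normal_mean_ge_cdf a b : a <= b -> (forall x, a <= x <= b -> h x = 1) ->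
  normal_cdf b - normal_cdf a <= \int[mu]_x (h x * p x).
Proof.
move=> ab hb; rewrite /normal_cdf Rintegral_itvB//; last exact: ip.
rewrite Rintegral_mkcond; apply: le_Rintegral => //.
  rewrite -restrict_EFin; apply/integrable_restrict => //.
  by rewrite setTI; exact: ip.
move=> x _; rewrite patchE; case: ifPn => [|_]; last exact: hp_ge0.
rewrite inE/= in_itv/= => /andP[ax xb].
by rewrite hb ?mul1r// ltW.
Qed.

End bounds.
End normal_facts.

(** * The de Moivre-Laplace theorem *)

Section de_moivre_laplace.
Variables (R : realType) (q : R).
Hypothesis q01 : 0 < q < 1.
Local Notation mu := (@lebesgue_measure R).
Local Notation E := (binomial_mean q).
Local Notation D := (scaled_count q).
Let v := q * (1 - q).
Let s := Num.sqrt v.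
Local Notation p := (normal_pdf 0 s).

Let q01' : 0 <= q <= 1.
Proof. by have /andP[? ?] := q01; rewrite !ltW. Qed.

Let v0 : 0 < v.
Proof. by have /andP[? ?] := q01; rewrite mulr_gt0// subr_gt0. Qed.

Let s0 : s != 0.
Proof. by rewrite gt_eqF// sqrtr_gt0. Qed.

Let s2 : s ^+ 2 = v.
Proof. by rewrite sqr_sqrtr// ltW. Qed.

Lemma near_inv_sqrt_le (e : R) : 0 < e ->
  \forall n \near \oo, (Num.sqrt (n%:R : R))^-1 <= e.
Proof.
move=> e0; near=> n.
have ne : (e^-1) ^+ 2 <= n%:R by near: n; exact: nbhs_infty_ger.
rewrite -[leRHS]invrK lef_pV2 ?posrE ?invr_gt0//.
- have <- : Num.sqrt (e^-1 ^+ 2) = e^-1.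
    by rewrite sqrtr_sqr gtr0_norm// invr_gt0.
  by rewrite ler_sqrt.
- by rewrite sqrtr_gt0 (lt_le_trans _ ne)// exprn_gt0// invr_gt0.
Unshelve. all: by end_near. Qed.

(** This is [scaled_count_stein_bound] for the solution of Stein's equation
    with right-hand side [h]. *)
Lemma binomial_mean_cvg0 (h : R -> R) (B : R) : continuous h ->
  (forall x, B <= `|x| -> h x = 0) -> \int[mu]_x (h x * p x) = 0 ->
  E n (fun k => h (D n k)) @[n --> \oo] --> (0 : R).
Proof.
move=> ch h0 Ih.
have [F [dF [F' FE cdF dF0]]] := stein_equation_solution s0 ch h0 Ih.
have [C C0 dFC] := compact_support_bounded cdF dF0.
have mvt x d : 0 < d ->
    exists2 t, 0 <= t <= d & F (x + d) - F x = d * dF (x + t).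
  move=> d0.
  have xd : x < x + d by rewrite ltrDl.
  have cF : {within `[x, x + d], continuous F}.
    apply: continuous_subspaceT => y; apply: differentiable_continuous.
    by apply/derivable1_diffP; have [] := F' y.
  have [c xcd ->] := MVT xd (fun y _ => F' y) cF.
  move: xcd; rewrite in_itv/= => /andP[xc cx]; exists (c - x).
    by rewrite subr_ge0 lerBlDl (ltW xc) (ltW cx).
  by rewrite [x + d - x]addrC addKr mulrC [x + (c - x)]addrC subrK.
apply/cvgrPdist_le => e e0.
have e2 : 0 < e / 2 by rewrite divr_gt0.
have [d0 d00 dFu] := compact_support_unif_continuous cdF dF0 e2.
near=> n.
have n0 : (0 < n)%N by near: n; exact: nbhs_infty_gt.
have sn0 : 0 < Num.sqrt (n%:R : R) by rewrite sqrtr_gt0 ltr0n.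
have dd0 : (Num.sqrt (n%:R : R))^-1 <= d0 by near: n; exact: near_inv_sqrt_le.
have dC : (Num.sqrt (n%:R : R))^-1 <= e / 2 * v / (C * (1 + v)).
  near: n; apply: near_inv_sqrt_le.
  by apply: divr_gt0; apply: mulr_gt0 => //; exact: addr_gt0.
rewrite sub0r normrN.
set d := (Num.sqrt (n%:R : R))^-1 in dd0 dC.
have dn : 0 < d by rewrite invr_gt0.
have H1 x : `|F (x + d) - F x| <= C * d.
  have [t _ ->] := mvt x _ dn.
  by rewrite normrM gtr0_norm// mulrC ler_wpM2r// ltW.
have H2 x : `|F (x + d) - F x - d * dF x| <= e / 2 * d.
  have [t /andP[t0 td] ->] := mvt x _ dn.
  rewrite -mulrBr normrM gtr0_norm// mulrC.
  by rewrite ler_wpM2r ?(ltW dn)// dFu// t0 (le_trans td).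
have := scaled_count_stein_bound q01' n0 H1 H2; rewrite -/v.
under eq_binomial_mean do rewrite -s2 FE s2.
rewrite binomial_meanZ normrM (gtr0_norm v0) => H.
rewrite -(ler_pM2l v0) (le_trans H)//.
have -> : v * e = v * (e / 2) + e / 2 * v by field.
rewrite lerD2l mulrAC mulrC -ler_pdivlMr//.
by apply: mulr_gt0 => //; exact: addr_gt0.
Unshelve. all: by end_near. Qed.

(* Since [f x <= x ^ 2 / A ^ 2] for all [x]. *)
Let chebyshev n A (f : R -> R) : (0 < n)%N -> 0 < A ->
  (forall x, `|x| <= A -> f x <= 0) -> (forall x, f x <= 1) ->
  E n (fun k => f (D n k)) <= v / A ^+ 2.
Proof.
move=> n0 A0 f0 f1.
have -> : v / A ^+ 2 = E n (fun k => (A ^+ 2)^-1 * D n k ^+ 2).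
  by rewrite binomial_meanZ scaled_count_variance// mulrC.
apply: le_binomial_mean => // k _.
have [xA|Ax] := leP `|D n k| A.
  by rewrite (le_trans (f0 _ xA))// mulr_ge0 ?sqr_ge0// invr_ge0 sqr_ge0.
apply: (le_trans (f1 _)); rewrite mulrC ler_pdivlMr ?exprn_gt0// mul1r.
by rewrite -[leRHS]real_normK ?num_real// lerXn2r ?nnegrE ?(ltW A0) ?(ltW Ax).
Qed.

Let chebyshev_radius (e : R) : 0 < e ->
  \forall A \near +oo, 0 < A /\ v / A ^+ 2 <= e.
Proof.
move=> e0; near=> A; split.
  by near: A; apply: nbhs_pinfty_gt; exact: num_real.
have A1 : 1 <= A by near: A; apply: nbhs_pinfty_ge; exact: num_real.
have Av : v / e <= A by near: A; apply: nbhs_pinfty_ge; exact: num_real.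
rewrite ler_pdivrMr ?exprn_gt0 ?(lt_le_trans _ A1)//.
rewrite ler_pdivrMr// in Av; rewrite (le_trans Av)// mulrC ler_pM2l// expr2.
by rewrite ler_peMl// (le_trans _ A1).
Unshelve. all: by end_near. Qed.

(** The condition of mean zero is removed by subtracting a multiple of a wide
    trapezoid [g], whose mean is close to one both under the normal law and,
    by Chebyshev's inequality, under the binomial laws. *)
Lemma binomial_mean_cvg (h : R -> R) (B : R) : continuous h ->
  (forall x, B <= `|x| -> h x = 0) -> (forall x, 0 <= h x <= 1) ->
  E n (fun k => h (D n k)) @[n --> \oo] --> (\int[mu]_x (h x * p x) : R).
Proof.
move=> ch h0 h01.
apply/cvgrPdist_le => e e0.
have e6 : 0 < e / 6 by rewrite divr_gt0.
have [A [A0 vA Ay AN]] : exists A : R, [/\ 0 < A, v / A ^+ 2 <= e / 6,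
    1 - e / 6 <= normal_cdf s A & normal_cdf s (- A) <= e / 6].
  near (+oo_R) => A.
  have [A0 vA] : 0 < A /\ v / A ^+ 2 <= e / 6.
    by near: A; exact: chebyshev_radius.
  exists A; split => //.
  - near: A; have /cvgrPdist_le/(_ _ e6) := normal_cdf_cvg1 s.
    by apply: filterS => x; rewrite ler_norml => /andP[_]; lra.
  - near: A; have := normal_cdf_cvg0 s; rewrite cvgNy_compNP.
    move=> /cvgrPdist_le/(_ _ e6).
    by apply: filterS => x /=; rewrite ler_norml => /andP[+ _]; lra.
pose g := trapezoid (- A) A 1.
have g0 x : `|- A| + `|A| + 1 <= `|x| -> g x = 0 by exact: trapezoid_supp.
have cg : continuous g by exact: continuous_trapezoid.
have g01 x : 0 <= g x <= 1 by rewrite trapezoid_ge0 trapezoid_le1.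
set Ih := \int[mu]_x (h x * p x); pose Ig := \int[mu]_x (g x * p x).
have Ih0 : 0 <= Ih by exact: normal_mean_ge0.
have Ih1 : Ih <= 1 by exact: (normal_mean_le1 s ch h0 h01).
have Ig1 : Ig <= 1 by exact: (normal_mean_le1 s cg g0 g01).
have Igl : 1 - e / 3 <= Ig.
  apply: (@le_trans _ _ (normal_cdf s A - normal_cdf s (- A))); first by lra.
  apply: (normal_mean_ge_cdf s cg g0 g01); first by lra.
  by move=> x xA; apply: trapezoid1.
pose k x := Ig * h x + - Ih * g x.
have ck : continuous k.
  move=> x; apply: cvgD; (apply: cvgM; first exact: cvg_cst).
    exact: ch.
  exact: cg.
have k0 x : `|B| + `|- A| + `|A| + 1 <= `|x| -> k x = 0.
  have := ler_norm B; have := normr_ge0 B; have := normr_ge0 A => ? ? ?.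
  by move=> Bx; rewrite /k h0 ?g0 ?mulr0 ?addr0//; rewrite normrN in Bx *; lra.
have Ik : \int[mu]_x (k x * p x) = 0.
  have ihp := integrable_mul_normal_pdf s ch h0.
  have igp := integrable_mul_normal_pdf s cg g0.
  under eq_Rintegral do rewrite /k mulrDl -!mulrA.
  rewrite RintegralD//; last 2 first.
  - by under [_ \o _]eq_fun do rewrite /= EFinM; exact: integrableZl.
  - by under [_ \o _]eq_fun do rewrite /= EFinM; exact: integrableZl.
  by rewrite !RintegralZl// -/Ih -/Ig mulNr mulrC subrr.
have /cvgrPdist_le/(_ _ e6) kE := binomial_mean_cvg0 ck k0 Ik.
near=> n.
have n0 : (0 < n)%N by near: n; exact: nbhs_infty_gt.
have : `|0 - E n (fun i => k (D n i))| <= e / 6 by near: n; exact: kE.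
rewrite sub0r normrN /k binomial_meanD !binomial_meanZ.
set Eh := E n (fun k => h (D n k)).
set Eg := E n (fun k => g (D n k)).
have Eh0 : 0 <= Eh.
  rewrite -(binomial_mean_cst q n 0); apply: le_binomial_mean => // i _.
  by have /andP[] := h01 (D n i).
have Eh1 : Eh <= 1.
  rewrite -(binomial_mean_cst q n 1); apply: le_binomial_mean => // i _.
  by have /andP[] := h01 (D n i).
have Eg1 : Eg <= 1.
  rewrite -(binomial_mean_cst q n 1); apply: le_binomial_mean => // i _.
  by have /andP[] := g01 (D n i).
have Egl : 1 - e / 6 <= Eg.
  suff : E n (fun i => 1 + -1 * g (D n i)) <= e / 6.
    by rewrite binomial_meanD binomial_meanZ binomial_mean_cst -/Eg; lra.
  apply: le_trans vA; apply: (@chebyshev n A (fun x => 1 + -1 * g x)) => // x.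
    by move=> xA; rewrite /g trapezoid1 -?ler_norml//; lra.
  by have /andP[] := g01 x; lra.
(* [Ih - Eh] is [Ih * (1 - Eg) - Eh * (1 - Ig) - (Ig * Eh - Ih * Eg)]. *)
have H1 : 0 <= Ih * (1 - Eg) <= e / 6.
  apply/andP; split; first by rewrite mulr_ge0// subr_ge0.
  by rewrite (le_trans (ler_piMl _ Ih1)) ?subr_ge0//; lra.
have H2 : 0 <= Eh * (1 - Ig) <= e / 3.
  apply/andP; split; first by rewrite mulr_ge0// subr_ge0.
  by rewrite (le_trans (ler_piMl _ Eh1)) ?subr_ge0//; lra.
move: H1 H2 => /andP[? ?] /andP[? ?].
by rewrite !ler_norml => /andP[? ?]; apply/andP; split; lra.
Unshelve. all: by end_near. Qed.

(** De Moivre-Laplace.  The indicator of the half-line ending at [x] is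
    sandwiched, up to the tail below [- A], between a trapezoid whose support
    ends at [x] and one whose support ends at [x + c]. *)
Lemma binomial_cdf_cvg (x : R) :
  E n (fun k => (D n k <= x)%R%:R) @[n --> \oo] --> (normal_cdf s x : R).
Proof.
apply/cvgrPdist_le => e e0.
have e3 : 0 < e / 3 by rewrite divr_gt0.
have [c [c0 cl cu]] : exists c : R, [/\ 0 < c,
    normal_cdf s x - e / 3 <= normal_cdf s (x - c) &
    normal_cdf s (x + c) <= normal_cdf s x + e / 3].
  have /cvgrPdist_le/(_ _ e3)/nbhs_ballP[r /= r0 H] :=
    @continuous_normal_cdf R s s0 x.
  exists (r / 2).
  have r2 : 0 < r / 2 by rewrite divr_gt0.
  have rr : r / 2 < r by rewrite ltr_pdivrMr// ltr_pMr// ltr1n.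
  split => //.
  - have := H (x - r / 2).
    rewrite /ball/= opprB addrC subrK gtr0_norm// => /(_ rr).
    by rewrite ler_norml => /andP[]; lra.
  - have := H (x + r / 2).
    rewrite /ball/= opprD addNKr normrN gtr0_norm// => /(_ rr).
    by rewrite ler_norml => /andP[]; lra.
have [A [A0 vA Ax AN]] : exists A : R, [/\ 0 < A, v / A ^+ 2 <= e / 3,
    - A <= x - c & normal_cdf s (- A) <= e / 6].
  near (+oo_R) => A.
  have [A0 vA] : 0 < A /\ v / A ^+ 2 <= e / 3.
    by near: A; exact: chebyshev_radius.
  exists A; split => //.
  - by rewrite lerNl; near: A; apply: nbhs_pinfty_ge; exact: num_real.
  - near: A; have := normal_cdf_cvg0 s; rewrite cvgNy_compNP.
    have e6 : 0 < e / 6 by rewrite divr_gt0.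
    move=> /cvgrPdist_le/(_ _ e6).
    by apply: filterS => y /=; rewrite ler_norml => /andP[+ _]; lra.
pose f := trapezoid (- A) x c; pose g := trapezoid (- A) (x - c) c.
have e6 : 0 < e / 6 by rewrite divr_gt0.
have fcvg : E n (fun k => f (D n k)) @[n --> \oo] -->
    (\int[mu]_x (f x * p x) : R).
  apply: (@binomial_mean_cvg f (`|- A| + `|x| + c)).
  - exact: continuous_trapezoid.
  - by move=> y; exact: trapezoid_supp.
  - by move=> y; rewrite trapezoid_ge0 trapezoid_le1.
have gcvg : E n (fun k => g (D n k)) @[n --> \oo] -->
    (\int[mu]_x (g x * p x) : R).
  apply: (@binomial_mean_cvg g (`|- A| + `|x - c| + c)).
  - exact: continuous_trapezoid.
  - by move=> y; exact: trapezoid_supp.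
  - by move=> y; rewrite trapezoid_ge0 trapezoid_le1.
have If : \int[mu]_x (f x * p x) <= normal_cdf s (x + c).
  apply: (@normal_mean_le_cdf _ s f (`|- A| + `|x| + c)).
  - exact: continuous_trapezoid.
  - by move=> y; exact: trapezoid_supp.
  - by move=> y; rewrite trapezoid_ge0 trapezoid_le1.
  - by move=> y xy; apply: trapezoid0r => //; exact: ltW.
have Ig : normal_cdf s (x - c) - normal_cdf s (- A) <= \int[mu]_x (g x * p x).
  apply: (@normal_mean_ge_cdf _ s g (`|- A| + `|x - c| + c)) => //.
  - exact: continuous_trapezoid.
  - by move=> y; exact: trapezoid_supp.
  - by move=> y; rewrite trapezoid_ge0 trapezoid_le1.
  - by move=> y xy; apply: trapezoid1.
near=> n.
have n0 : (0 < n)%N by near: n; exact: nbhs_infty_gt.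
have fn : `|(\int[mu]_x (f x * p x)) - E n (fun k => f (D n k))| <= e / 6.
  by near: n; move/cvgrPdist_le : fcvg; apply.
have gn : `|(\int[mu]_x (g x * p x)) - E n (fun k => g (D n k))| <= e / 6.
  by near: n; move/cvgrPdist_le : gcvg; apply.
have Eu : E n (fun k => (D n k <= x)%R%:R) <= E n (fun k => f (D n k)) + e / 3.
  rewrite -lerBlDl.
  have -> : E n (fun k => (D n k <= x)%R%:R) - E n (fun k => f (D n k)) =
      E n (fun k => (D n k <= x)%R%:R + -1 * f (D n k)).
    by rewrite binomial_meanD binomial_meanZ mulN1r.
  apply: le_trans vA.
  apply: (@chebyshev n A (fun y => (y <= x)%R%:R + -1 * f y)) => // y.
    rewrite ler_norml => /andP[Ay yA].
    case: (leP y x) => yx; last first.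
      by have := trapezoid_ge0 (- A) x c y; rewrite -/f mulr0n; lra.
    have -> : f y = 1 by apply: trapezoid1; rewrite ?Ay.
    by rewrite mulr1n; lra.
  have := trapezoid_ge0 (- A) x c y; rewrite -/f.
  by case: (leP y x) => _ /=; lra.
have El : E n (fun k => g (D n k)) <= E n (fun k => (D n k <= x)%R%:R).
  apply: le_binomial_mean => // k _.
  case: (leP (D n k) x) => xk.
    by rewrite mulr1n; exact: trapezoid_le1.
  by rewrite /g trapezoid0r // subrK ltW.
move: fn gn; rewrite !ler_norml => /andP[f1 f2] /andP[g1 g2].
by apply/andP; split; lra.
Unshelve. all: by end_near. Qed.

End de_moivre_laplace.

(** * Sampled patches *)

Lemma binomial_mean_subsets (R : realType) (q : R) (I : finType)
    (f : nat -> R) :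
  \sum_(J : {set I}) f #|J| * (q ^+ #|J| * (1 - q) ^+ (#|I| - #|J|)) =
  binomial_mean q #|I| f.
Proof.
have cardJ (J : {set I}) : (#|J| < #|I|.+1)%N by rewrite ltnS max_card.
rewrite (partition_big (fun J => Ordinal (cardJ J)) predT)//=.
apply: eq_bigr => k _.
rewrite (eq_bigr (fun=> f k * (q ^+ k * (1 - q) ^+ (#|I| - k)))); last first.
  by move=> J /eqP <-.
rewrite sumr_const.
have -> : #|[pred J : {set I} | Ordinal (cardJ J) == k]| = 'C(#|I|, k).
  by rewrite -card_draws -cardsE; apply: eq_card => J; rewrite !inE.
by rewrite /binomial_weight -mulr_natl; ring.
Qed.

Section sampling.
Variables (R : realType) (g : grid) (L : nat).
Variables (ident : grid_patch g -> {set 'I_L}) (s : {set 'I_L}).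
Local Notation q := (true_prob R ident s).

Lemma true_prob01 : 0 <= q <= 1.
Proof.
rewrite /true_prob divr_ge0//=.
have [->|c0] := eqVneq #|{: grid_patch g}| 0%N; first by rewrite invr0 mulr0.
by rewrite ler_pdivrMr ?ltr0n ?lt0n// mul1r ler_nat max_card.
Qed.

Section one_space.
Variables (d : measure_display) (T : measurableType d) (P : probability T R).

Lemma prob_ident (X : {RV P >-> grid_patch g}) : uniform_on_patches X ->
  P (X @^-1` [set a | ident a = s]) = q%:E.
Proof.
move=> uX; pose r := enum [set a : grid_patch g | ident a == s]%SET.
have -> : [set a | ident a = s] = \bigcup_(a in [set` r]) [set a].
  apply/seteqP; split=> [a /= ia|a [b /=]].
    by exists a => //=; rewrite mem_enum inE ia.
  by rewrite mem_enum inE => /eqP ? ->.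
transitivity (distribution P X (\bigcup_(a in [set` r]) [set a])) => //.
rewrite measure_fin_bigcup//=; last first.
  by move=> a b _ _ [c [/= -> ->]].
rewrite -fsbig_seq ?enum_uniq//= big_enum/=.
rewrite (eq_bigr (fun=> (#|{: grid_patch g}|%:R^-1)%:E)); last first.
  by move=> a _; exact: uX.
by rewrite sumEFin sumr_const /true_prob mulr_natl.
Qed.

Variables (N : nat) (X : 'I_N -> {RV P >-> grid_patch g}).
Hypothesis iidX : iid_uniform X.

(* The set of the samples that yield the support [s]. *)
Let hits (w : T) : {set 'I_N} := [set i : 'I_N | ident (X i w) == s]%SET.

Let hits_event (J : {set 'I_N}) (i : 'I_N) : set (grid_patch g) :=
  if i \in J then [set a | ident a = s] else ~` [set a | ident a = s].

Let preimage_hits (J : {set 'I_N}) : hits @^-1` [set J] =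
  \bigcap_(i in [set i | i \in [set: 'I_N]%SET]) (X i @^-1` hits_event J i).
Proof.
apply/seteqP; split=> [w /= <- i _|w /= H].
  by rewrite /hits_event inE /=; case: eqP.
apply/setP => i; have := H i; rewrite /hits_event/= !inE => /(_ isT).
by case: ifP => _ /eqP // /negbTE.
Qed.

Let measurable_hits J : measurable (hits @^-1` [set J]).
Proof.
rewrite preimage_hits; apply: fin_bigcap_measurable => // i _.
rewrite -[X in measurable X]setTI; exact: (measurable_funPT (X i)).
Qed.

(* The event prescribes, for every sample, whether it yields [s]; hence it
   factors by independence. *)
Let prob_hits J : P (hits @^-1` [set J]) =
  (q ^+ #|J| * (1 - q) ^+ (N - #|J|))%:E.
Proof.
have [indep unif] := iidX.
rewrite preimage_hits indep//.
rewrite (eq_bigr (fun i => (if i \in J then q else 1 - q)%:E)); last first.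
  move=> i _; rewrite /hits_event; case: ifP => _; first exact: prob_ident.
  rewrite -preimage_setC probability_setC ?prob_ident//.
  by rewrite -[X in measurable X]setTI; exact: (measurable_funPT (X i)).
rewrite prodEFin; congr (_%:E).
rewrite (eq_bigl xpredT); last by move=> i; rewrite inE.
rewrite (bigID (mem J))/=; congr (_ * _).
  rewrite (eq_bigr (fun=> q)); last by move=> i ->.
  by rewrite prodr_const.
rewrite (eq_bigr (fun=> 1 - q)); last by move=> i /negbTE ->.
rewrite prodr_const; congr (_ ^+ _).
have -> : (N - #|J| = #|[predC J]|)%N.
  apply/eqP; rewrite -(eqn_add2l #|J|) cardC card_ord subnKC//.
  by rewrite -[leqRHS]card_ord max_card.
by apply: eq_card => i; rewrite !inE.
Qed.

(** The number of samples that yield the support [s] is binomial. *)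
Lemma integral_hit_count (f : nat -> R) : (forall k, 0 <= f k) ->
  (\int[P]_w (f #|[set i : 'I_N | ident (X i w) == s]%SET|)%:E)%E =
  (binomial_mean q N f)%:E.
Proof.
move=> f0.
transitivity (\int[P]_w (\sum_(J : {set 'I_N})
    (f #|J| * \1_(hits @^-1` [set J]) w)%:E))%E.
  apply: eq_integral => w _; rewrite (bigD1 (hits w))//= big1 ?adde0.
    by rewrite indicE mem_set// mulr1.
  move=> J /eqP Jw; rewrite indicE memNset ?mulr0//= => e.
  by apply: Jw; rewrite -e.
rewrite ge0_integral_sum//; last 2 first.
- move=> J; apply/measurable_EFinP; apply: measurable_funM.
    exact: measurable_cst.
  apply: measurable_indic; exact: measurable_hits.
- by move=> J w _; rewrite lee_fin mulr_ge0.
rewrite (eq_bigr (fun J : {set 'I_N} =>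
    (f #|J| * (q ^+ #|J| * (1 - q) ^+ (N - #|J|)))%:E)); last first.
  move=> J _; under eq_integral do rewrite EFinM.
  rewrite ge0_integralZl_EFin//; last first.
    by apply/measurable_EFinP; apply: measurable_indic; exact: measurable_hits.
  rewrite integral_indic// setIT [in RHS]EFinM; congr (_ * _)%E.
  exact: prob_hits.
rewrite sumEFin; congr (_%:E).
by have := binomial_mean_subsets q 'I_N f; rewrite card_ord => ->.
Qed.

Lemma cdf_scaled_deviation (x : R) :
  cdf (scaled_deviation ident s X : {RV P >-> R}) x =
  (binomial_mean q N (fun k => (scaled_count q N k <= x)%R%:R))%:E.
Proof.
rewrite -integral_hit_count; last by move=> k; rewrite ler0n.
rewrite /cdf /distribution /pushforward.
rewrite -[in LHS](setIT (_ @^-1` _)) -integral_indic//; last first.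
  rewrite -[X in measurable X]setTI; exact: measurable_scaled_deviation.
apply: eq_integral => w _; rewrite indicE; congr (_%:R%:E); congr nat_of_bool.
by apply/idP/idP; rewrite inE/= in_itv/=.
Qed.

Lemma mean_square_deviation : (0 < N)%N ->
  ('E_P[fun w => ((empirical_prob ident s X w - q) ^+ 2)%R])%E =
  (q * (1 - q) / N%:R)%:E.
Proof.
move=> N0; rewrite unlock.
rewrite -(scaled_count_variance q N0).
rewrite (integral_hit_count (f := fun k => (k%:R / N%:R - q) ^+ 2)); last first.
  by move=> k; rewrite sqr_ge0.
congr (_%:E); rewrite mulrC -binomial_meanZ; apply: eq_binomial_mean => k _.
by rewrite /scaled_count exprMn sqr_sqrtr// mulKf// pnatr_eq0 -lt0n.
Qed.

End one_space.
End sampling.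

Theorem theorem4p2p1 (R : realType) (g : grid) (L : nat)
    (ident : grid_patch g -> {set 'I_L}) (s : {set 'I_L}) :
  let q : R := true_prob R ident s in
  (forall (N : nat) (d : measure_display) (T : measurableType d)
      (P : probability T R) (X : 'I_N -> {RV P >-> grid_patch g}),
      (0 < N)%N -> iid_uniform X ->
      ('E_P[fun w => ((empirical_prob ident s X w - q) ^+ 2)%R])%E
        = (q * (1 - q) / N%:R)%:E)
  /\
  (forall (d : nat -> measure_display) (T : forall N, measurableType (d N))
      (P : forall N, probability (T N) R)
      (X : forall N, 'I_N -> {RV (P N) >-> grid_patch g}),
      (forall N, iid_uniform (X N)) ->
      cvg_in_distribution
        (fun N => scaled_deviation ident s (X N) : {RV (P N) >-> R})
        (gaussian 0 (q * (1 - q)))).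
Proof.
have q01 := true_prob01 R ident s.
move=> q; split => [N d T P X N0 iidX|d T P X iidX x _].
  exact: mean_square_deviation.
rewrite (funext (fun n => cdf_scaled_deviation ident s (iidX n) x)) -/q.
rewrite /gaussian; case: eqVneq => [v0|v0].
- rewrite [X in _ --> X](_ : _ = ((0 <= x)%R%:R : R)%:E); last first.
    rewrite /= diracE; congr (_%:R%:E); congr nat_of_bool.
    by apply/idP/idP; rewrite inE/= in_itv/=.
  apply: cvg_near_cst; near=> n.
  rewrite (binomial_mean_degenerate (fun y => (y <= x)%R%:R) q01 v0)//.
  by near: n; exact: nbhs_infty_gt.
- have q01s : 0 < q < 1.
    have /andP[q0 q1] := q01; move: v0; rewrite mulf_eq0 negb_or subr_eq0.
    move=> /andP[q0' q1']; rewrite !lt_neqAle q0 q1 !andbT.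
    by rewrite eq_sym q0' eq_sym.
  rewrite [X in _ --> X](normal_probE (Num.sqrt (q * (1 - q))) x).
  by apply: cvg_EFin; [exact: nearW|exact: binomial_cdf_cvg].
Unshelve. all: by end_near. Qed.
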